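(* Let $q$ be a prime power, let $1 \le k < n \le m$ be integers, let $\boldsymbol{g} = (g_1,\dots,g_n) \in \mathbb{F}_{q^m}^n$ have entries linearly independent over $\mathbb{F}_q$, and let $t$ be an integer with $0 \le t \le \lfloor \frac{n-k}{2} \rfloor$. Let $\boldsymbol{y} = \boldsymbol{c} + \boldsymbol{e} \in \mathbb{F}_{q^m}^n$, where $\boldsymbol{c} = (C(g_1),\dots,C(g_n))$ for some $q$-polynomial $C$ over $\mathbb{F}_{q^m}$ of $q$-degree $< k$ (so that $\boldsymbol{c}$ is a codeword of the Gabidulin code $\mathscr{G}_k(\boldsymbol{g})$), and where $\boldsymbol{e} \in \mathbb{F}_{q^m}^n$ has rank weight $t$. Let $Y$ be the unique $q$-polynomial over $\mathbb{F}_{q^m}$ of $q$-degree $< n$ such that $Y(g_i) = y_i$ for all $i \in \{1,\dots,n\}$, and let $G$ be a $q$-polynomial over $\mathbb{F}_{q^m}$ of $q$-degree $\le m-n$ such that the image of the induced $\mathbb{F}_q$-linear map $\mathbb{F}_{q^m}\to\mathbb{F}_{q^m}$ is the $\mathbb{F}_q$-span of $g_1,\dots,g_n$. Consider the following problem in the unknown $q$-polynomials $\Lambda, N$ over $\mathbb{F}_{q^m}$: $$ Y \circ G \circ \Lambda \equiv N \mod (X^{q^m}-X), \qquad \deg_q \Lambda \le t, \qquad \deg_q N \le (k+m-n)+t-1. $$ Then this problem has a solution $(\Lambda,N) \ne (0,0)$, and every solution $(\Lambda, N)\neq (0,0)$ satisfies $\Lambda \neq 0$ and $N = C \circ G \circ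 \Lambda$. Consequently $C$ (and hence the codeword $\boldsymbol{c}$) is recovered from any nonzero solution by dividing $N$ on the right by $\Lambda$ and then by $G$; that is, this right-hand side decoding procedure corrects every error of rank weight $t \le \lfloor\frac{n-k}{2}\rfloor$.
   Context: A $q$-polynomial over $\mathbb{F}_{q^m}$ is a polynomial of the form $P(X) = p_0X + p_1X^q + \dots + p_rX^{q^r}$ with $p_i \in \mathbb{F}_{q^m}$; if $p_r \ne 0$, its $q$-degree is $\deg_q(P) = r$ (the zero polynomial satisfies every upper bound on the $q$-degree). The $q$-polynomials form a non-commutative ring under addition and composition $\circ$, which is left and right Euclidean. A $q$-polynomial $P$ induces an $\mathbb{F}_q$-linear map $\mathbb{F}_{q^m} \to \mathbb{F}_{q^m}$, $x \mapsto P(x)$; the kernel of the map from $q$-polynomials to $\mathrm{Hom}_{\mathbb{F}_q}(\mathbb{F}_{q^m},\mathbb{F}_{q^m})$ is the two-sided ideal generated by $X^{q^m}-X$, so two $q$-polynomials are congruent modulo $(X^{q^m}-X)$ if and only if they induce the same map on $\mathbb{F}_{q^m}$. The rank weight of a vector $\boldsymbol{x} = (x_1,\dots,x_n) \in \mathbb{F}_{q^m}^n$ is the dimension over $\mathbb{F}_q$ of the $\mathbb{F}_q$-span of $x_1,\dots,x_n$ in $\mathbb{F}_{q^m}$ (equivalently, the rank of the $m \times n$ matrix over $\mathbb{F}_q$ whose columns are the coordinates of the $x_i$ in a basis of $\mathbb{F}_{q^m}/\mathbb{F}_q$). For $\boldsymbol{g} = (g_1,\dots,g_n)\in\mathbb{F}_{q^m}^n$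 with entries linearly independent over $\mathbb{F}_q$, the Gabidulin code of dimension $k$ is $\mathscr{G}_k(\boldsymbol{g}) = \{(P(g_1),\dots,P(g_n)) \mid P \text{ a } q\text{-polynomial over } \mathbb{F}_{q^m},\ \deg_q P < k\}$. A $q$-polynomial $G$ as in the claim always exists. *)

(* Defs.v *)
(* F_q is a [finFieldType] F with #|F| = q, and F_(q^m) is a degree-m
   [fieldExtType F].  q-polynomials are ordinary polynomials over F_(q^m) of a
   special shape; their ring product is the polynomial composition \Po, where
   [(A \Po B).[x] = A.[B.[x]]]. *)
From HB Require Import structures.
From mathcomp Require Import all_boot all_order all_algebra all_field.

Set Implicit Arguments.
Unset Strict Implicit.
Unset Printing Implicit Defensive.

Import GRing.Theory.
Local Open Scope ring_scope.

Definition is_qpoly (q : nat) (L : fieldType) (P : {poly L}) : Prop :=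
  exists (r : nat) (p : nat -> L), P = \sum_(i < r.+1) p i *: 'X^(q ^ i).

(* The bound [i < size P] loses nothing when 1 < q: a nonzero coefficient at
   q ^ i forces i < q ^ i < size P.  The value at P = 0 is junk. *)
Definition qdeg (q : nat) (L : fieldType) (P : {poly L}) : nat :=
  \max_(i < size P | P`_(q ^ i) != 0) i.

Definition qdeg_lt (q : nat) (L : fieldType) (P : {poly L}) (d : nat) : bool :=
  (P == 0) || (qdeg q P < d)%N.

Definition qdeg_le (q : nat) (L : fieldType) (P : {poly L}) (d : nat) : bool :=
  (P == 0) || (qdeg q P <= d)%N.

(* A - B lies in the two-sided ideal generated by 'X^(q ^ m) - 'X in the ring of
   q-polynomials under addition and composition. *)
Definition qcongr (q m : nat) (L : fieldType) (A B : {poly L}) : Prop :=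
  exists2 s : seq ({poly L} * {poly L}),
    forall u, u \in s -> is_qpoly q u.1 /\ is_qpoly q u.2 &
    A - B = \sum_(u <- s) (u.1 \Po (('X^(q ^ m) - 'X) \Po u.2)).

(* Q and R are the quotient and remainder of the Euclidean division of A by B
   on the right. *)
Definition right_division (q : nat) (L : fieldType) (A B Q R : {poly L}) : Prop :=
  [/\ is_qpoly q Q, is_qpoly q R, A = (Q \Po B) + R & qdeg_lt q R (qdeg q B)].

Definition eval_vec (L : fieldType) (n : nat) (P : {poly L}) (g : 'rV[L]_n) :
  'rV[L]_n := \row_i P.[g 0 i].

Definition entries (L : Type) (n : nat) (x : 'rV[L]_n) : n.-tuple L :=
  [tuple x 0 i | i < n].

Definition rank_weight (F : fieldType) (L : fieldExtType F) (n : nat)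
  (x : 'rV[L]_n) : nat := \dim <<entries x>>%VS.

Definition key_solution (q m n k t : nat) (L : fieldType)
  (Y G Lam N : {poly L}) : Prop :=
  [/\ is_qpoly q Lam, is_qpoly q N,
      qcongr q m (Y \Po (G \Po Lam)) N,
      qdeg_le q Lam t &
      qdeg_le q N ((k + m - n) + t - 1)].

(* v is a possible output of the decoder: take some nonzero solution (Lam, N),
   divide N on the right by Lam, divide the quotient on the right by G, and
   evaluate the last quotient at g. *)
Definition decoder_output (q m n k t : nat) (L : fieldType)
  (g : 'rV[L]_n) (Y G : {poly L}) (v : 'rV[L]_n) : Prop :=
  exists Lam N Q1 R1 Q2 R2 : {poly L},
    [/\ key_solution q m n k t Y G Lam N, (Lam, N) <> (0, 0),
        right_division q N Lam Q1 R1, right_division q Q1 G Q2 R2 &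
        v = eval_vec Q2 g].

(* Main.v *)
Require Import Defs.
From HB Require Import structures.
From mathcomp Require Import all_boot all_order all_algebra all_field.
From mathcomp Require Import zify.

(** Put E = Y - C.  It maps the span of g onto the span of e, so E o G has rank
    t on L.  Counting F-dimensions gives a nonzero Lam of q-degree at most t with
    E o G o Lam = 0 on L, and then (Lam, C o G o Lam) solves the problem.
    Conversely, for any solution (Lam, N), the q-polynomial N - C o G o Lam agrees
    with E o G o Lam on L, so its kernel there has dimension at least m - t; its
    q-degree is at most k + m - n + t - 1 < m - t, so it is zero.  Both divisions
    are then exact, and q-degrees show that the quotients are unique. *)

Set Implicit Arguments.
Unset Strict Implicit.
Unset Printing Implicit Defensive.

Import GRing.Theory.
Local Open Scope ring_scope.

Lemma size_comp_expn_leq (R : idomainType) (P Q : {poly R}) q a b :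
  (size P <= (q ^ a).+1)%N -> (size Q <= (q ^ b).+1)%N ->
  (size (P \Po Q) <= (q ^ (a + b)).+1)%N.
Proof.
have := size_comp_poly P Q; rewrite expnD.
by move: (q ^ a)%N (q ^ b)%N (size _) (size _) (size _) => u v x y z *; nia.
Qed.

(** * Shape, degree and right division of q-polynomials *)

Section QPoly.
Variables (q : nat) (L : fieldType).
Implicit Types P Q : {poly L}.
Hypothesis q_gt1 : (1 < q)%N.

(** Working with the support avoids aligning the summation bounds [r] of two q-polynomials in the
    closure proofs. *)
Lemma is_qpolyP P :
  is_qpoly q P <-> forall j, P`_j != 0 -> exists i, j = (q ^ i)%N.
Proof.
split=> [[r [p ->]] j | hP].
  rewrite coef_sum => nz.
  have [/existsP[i /eqP ->] | /existsPn h] :=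
    boolP [exists i : 'I_r.+1, j == (q ^ i)%N]; first by exists i.
  case/eqP: nz; apply: big1 => i _.
  by rewrite coefZ coefXn (negPf (h i)) mulr0.
exists (size P), (fun i => P`_(q ^ i)); apply/polyP => j; rewrite coef_sum.
have expq_inj : injective (expn q) by exact: expnI.
have [Pj0 | nz] := eqVneq P`_j 0.
  rewrite Pj0 big1 // => i _; rewrite coefZ coefXn.
  by have [<- | _] := eqVneq j (q ^ i)%N; rewrite ?Pj0 ?mul0r ?mulr0.
have [i def_j] := hP j nz.
have lt_i : (i < (size P).+1)%N.
  rewrite ltnS ltnW // (leq_trans (ltn_expl i q_gt1)) // -def_j ltnW //.
  by rewrite ltnNge; apply: contra nz => /(nth_default 0) ->.
rewrite (bigD1 (Ordinal lt_i)) //= big1 => [|l /negP ne_l].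
  by rewrite coefZ coefXn def_j eqxx mulr1 addr0.
rewrite coefZ coefXn def_j; case: eqP => [/expq_inj e|_]; last by rewrite mulr0.
by case: ne_l; apply/eqP/val_inj.
Qed.

Lemma is_qpolyD P Q : is_qpoly q P -> is_qpoly q Q -> is_qpoly q (P + Q).
Proof.
move=> /is_qpolyP hP /is_qpolyP hQ; apply/is_qpolyP => j; rewrite coefD.
by have [->|/hP//] := eqVneq P`_j 0; rewrite add0r => /hQ.
Qed.

Lemma is_qpoly0 : is_qpoly q (0 : {poly L}).
Proof. by apply/is_qpolyP => j; rewrite coef0 eqxx. Qed.

Lemma is_qpolyN P : is_qpoly q P -> is_qpoly q (- P).
Proof.
by move=> /is_qpolyP hP; apply/is_qpolyP => j; rewrite coefN oppr_eq0 => /hP.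
Qed.

Lemma is_qpolyB P Q : is_qpoly q P -> is_qpoly q Q -> is_qpoly q (P - Q).
Proof. by move=> hP hQ; apply/is_qpolyD/is_qpolyN. Qed.

Lemma is_qpolyZXn c i : is_qpoly q (c *: 'X^(q ^ i) : {poly L}).
Proof.
apply/is_qpolyP => j; rewrite coefZ coefXn.
by have [-> _|_] := eqVneq j (q ^ i)%N; [exists i | rewrite mulr0 eqxx].
Qed.

Lemma is_qpoly_sum (I : Type) (r : seq I) (E : I -> {poly L}) :
  (forall i, is_qpoly q (E i)) -> is_qpoly q (\sum_(i <- r) E i).
Proof.
move=> hE; apply: (big_ind (@is_qpoly q L)) => //; first exact: is_qpoly0.
exact: is_qpolyD.
Qed.

Lemma is_qpolyX : is_qpoly q ('X : {poly L}).
Proof. by have := is_qpolyZXn 1 0; rewrite scale1r expn0 expr1. Qed.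

Lemma horner0_qpoly P : is_qpoly q P -> P.[0] = 0.
Proof.
move=> /is_qpolyP hP; rewrite horner_coef0; apply/eqP/negPn/negP => /hP[i] e.
by have := expn_gt0 q i; rewrite -e (ltnW q_gt1).
Qed.

(** The leading exponent is some [q ^ i], and no nonzero coefficient lies higher. Bounds on the
    q-degree thus become bounds on [size], which also cover the zero polynomial. *)
Lemma size_qpoly P : is_qpoly q P -> P != 0 -> size P = (q ^ qdeg q P).+1.
Proof.
move=> /is_qpolyP hP nzP; have szP : (0 < size P)%N by rewrite size_poly_gt0.
have [|i def_i] := hP (size P).-1; first by rewrite -lead_coefE lead_coef_eq0.
have szE : size P = (q ^ i).+1 by rewrite -def_i prednK.
suff <- : i = qdeg q P by [].
have lt_i : (i < size P)%N by rewrite szE ltnS ltnW // ltn_expl.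
apply/eqP; rewrite eqn_leq; apply/andP; split.
  rewrite (@leq_bigmax_cond _ _ (fun i : 'I__ => i : nat) (Ordinal lt_i)) //=.
  by rewrite -def_i -lead_coefE lead_coef_eq0.
apply/bigmax_leqP => j nz; rewrite -(leq_exp2l _ _ q_gt1) -ltnS -szE ltnNge.
by apply: contra nz => /(nth_default 0) ->.
Qed.

Lemma size_qpoly_gt1 P : is_qpoly q P -> P != 0 -> (1 < size P)%N.
Proof.
by move=> hP nzP; rewrite size_qpoly // ltnS expn_gt0 (ltnW q_gt1).
Qed.

Lemma qdeg_leE P d :
  is_qpoly q P -> qdeg_le q P d = (size P <= (q ^ d).+1)%N.
Proof.
rewrite /qdeg_le => hP; have [->|nzP] := eqVneq P 0; first by rewrite size_poly0.
by rewrite size_qpoly // ltnS leq_exp2l.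
Qed.

Lemma qdeg_lt_le P d : (0 < d)%N -> qdeg_lt q P d = qdeg_le q P d.-1.
Proof. by rewrite /qdeg_lt /qdeg_le; case: d. Qed.

Lemma comp_qpoly_eq0 P Q : is_qpoly q Q -> Q != 0 ->
  (P \Po Q == 0) = (P == 0).
Proof. by move=> hQ nzQ; rewrite comp_poly_eq0 ?size_qpoly_gt1. Qed.

(** Subtracting gives [(P - Q) \Po B = R]. Degrees multiply under composition, so a nonzero [P - Q]
    would make the degree of [R] at least that of [B]. *)
Lemma right_division_remainder P Q R B :
  is_qpoly q P -> is_qpoly q B -> B != 0 ->
  right_division q (P \Po B) B Q R -> Q = P /\ R = 0.
Proof.
move=> hP hB nzB [hQ hR eqPB ltRB].
have eqR : (P - Q) \Po B = R by rewrite comp_polyB eqPB addrC addKr.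
have [PQ|nzPQ] := eqVneq (P - Q) 0.
  by split; [apply/esym/subr0_eq | rewrite -eqR PQ comp_poly0].
have nzR : R != 0 by rewrite -eqR comp_qpoly_eq0.
have : (size R < size B)%N.
  move: ltRB; rewrite /qdeg_lt (negPf nzR) /= => ltRB.
  by rewrite !size_qpoly // ltnS ltn_exp2l.
have := size_comp_poly (P - Q) B; rewrite eqR.
have := size_qpoly_gt1 (is_qpolyB hP hQ) nzPQ.
have := size_qpoly_gt1 hB nzB.
case: (size B) => [|[|b]] // _; case: (size (P - Q)) => [|[|a]] // _ /=.
by case: (size R) => // r /= ->; nia.
Qed.

End QPoly.

(** * Composition when [q] is a power of the characteristic *)

Section CharQ.
Variables (q : nat) (L : fieldType).
Implicit Types P Q : {poly L}.
Hypothesis q_gt1 : (1 < q)%N.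
Hypothesis char_q : [pchar L].-nat q.

Lemma pnat_expq i : [pchar {poly L}].-nat (q ^ i)%N.
Proof. by rewrite (eq_pnat _ (@pchar_poly L)) pnatX char_q. Qed.

(** Raising to the power [q ^ i] is additive here, so monomials compose term by term and the
    exponents of [q] add up. *)
Lemma is_qpoly_comp P Q : is_qpoly q P -> is_qpoly q Q -> is_qpoly q (P \Po Q).
Proof.
move=> [r [p ->]] [s [b ->]]; rewrite linear_sum /=; apply: is_qpoly_sum => // i.
rewrite linearZ /= comp_Xn_poly.
have -> : (\sum_(l < s.+1) b l *: 'X^(q ^ l)) ^+ (q ^ i) =
    \sum_(l < s.+1) (b l ^+ (q ^ i)) *: 'X^(q ^ (l + i)) :> {poly L}.
  elim/big_rec2: _ => [|l y1 y2 _ <-].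
    by rewrite expr0n expn_eq0 (gtn_eqF (ltnW q_gt1)).
  by rewrite exprDn_pchar ?pnat_expq // exprZn -exprM expnD.
rewrite scaler_sumr; apply: is_qpoly_sum => // l.
by rewrite scalerA; apply: is_qpolyZXn.
Qed.

(** Reduction step that trades ['X^(q ^ (m + i))] for ['X^(q ^ i)]; the right factor ['X] only gives
    the left side the shape of a term in [qcongr]. *)
Lemma comp_Xn_subX m i (c : L) :
  (c *: 'X^(q ^ i)) \Po (('X^(q ^ m) - 'X) \Po 'X) =
  c *: 'X^(q ^ (m + i)) - c *: 'X^(q ^ i).
Proof.
rewrite comp_polyXr comp_polyZ comp_Xn_poly -scalerBr; congr (_ *: _).
apply/eqP; rewrite eq_sym subr_eq.
by rewrite -exprDn_pchar ?pnat_expq // subrK -exprM expnD.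
Qed.

End CharQ.

(** * Linear maps, kernels and dimensions *)

Section LinearMaps.
Variables (K : fieldType) (U W : vectType K).

(** Makes evaluation of a q-polynomial a ['Hom], so that rank-nullity applies to it. *)
Lemma exists_linfun (f : U -> W) :
  (forall (a : K) x y, f (a *: x + y) = a *: f x + f y) ->
  exists h : 'Hom(U, W), forall x, h x = f x.
Proof.
move=> f_lin.
pose lf : {linear U -> W} := HB.pack f (GRing.isLinear.Build _ _ _ _ f f_lin).
by exists (linfun lf) => x; rewrite lfunE.
Qed.

Lemma hom_nontrivial_ker (h : 'Hom(U, W)) :
  (\dim {:W} < \dim {:U})%N -> exists2 u, u != 0 & h u = 0.
Proof.
move=> ltWU; exists (vpick (lker h)).
  rewrite vpick0 -dimv_eq0 -lt0n.
  have := limg_ker_dim h fullv; rewrite capfv.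
  have := dimvS (subvf (h @: fullv)%VS); lia.
by apply/eqP; rewrite -memv_ker memv_pick.
Qed.

Lemma dim_ffun n : \dim {: {ffun 'I_n -> U}} = (n * \dim {:U})%N.
Proof. by rewrite !dimvf; congr (_ * _)%N; rewrite card_ord. Qed.

Lemma dim_subvs (E : {vspace U}) : \dim {: subvs_of E} = \dim E.
Proof. by rewrite dimvf. Qed.

End LinearMaps.

(** * Vanishing and congruence of q-polynomials on [L] *)

Section QCongr.
Variables (q m : nat) (F : finFieldType) (L : fieldExtType F).
Implicit Types (P Q A B : {poly L}) (V : {vspace L}).
Hypothesis card_F : #|F| = q.
Hypothesis dim_L : \dim {:L} = m.

Lemma card_fin_gt1 : (1 < q)%N.
Proof. by rewrite -card_F finNzRing_gt1. Qed.

Lemma pchar_nat_card : [pchar L].-nat q.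
Proof.
have [p p_pr pF] := finPcharP F; rewrite -card_F (eq_pnat _ (@pchar_lalg F L)).
rewrite (eq_pnat _ (pcharf_eq pF)) -cardsT.
exact: pprimeChar_pgroup pF.
Qed.

Lemma exprF_q (a : F) i : a ^+ (q ^ i) = a.
Proof.
by elim: i => [|i IHi]; rewrite ?expn0 // expnSr exprM IHi -card_F expf_card.
Qed.

Lemma exprL_qm (x : L) : x ^+ (q ^ m) = x.
Proof.
apply/eqP; rewrite -card_F -dim_L.
by have := Fermat's_little_theorem {:L}%AS x; rewrite memvf => /esym.
Qed.

Lemma size_vanishing P V : P != 0 -> (forall x, x \in V -> P.[x] = 0) ->
  (q ^ \dim V < size P)%N.
Proof.
(* Viewing [V] over [finvect_type L] makes its [q ^ \dim V] points, all roots of [P], enumerable. *)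
move=> nzP P_V; pose W : {vspace finvect_type L} := V.
have <- : size (enum W) = (q ^ \dim V)%N by rewrite -cardE card_vspace card_F.
apply: (@max_poly_roots L P (enum W) nzP) (enum_uniq W).
apply/allP=> x; have -> : (x \in enum W) = (x \in W) := mem_enum _ _.
by move/P_V/eqP.
Qed.

Lemma horner_qpoly_linear P (a : F) (x y : L) : is_qpoly q P ->
  P.[a *: x + y] = a *: P.[x] + P.[y].
Proof.
move=> [r [p ->]]; rewrite !horner_sum scaler_sumr -big_split /=.
apply: eq_bigr => i _; rewrite !hornerZ !hornerXn exprDn_pchar; last first.
  by rewrite pnatX pchar_nat_card.
by rewrite exprZn exprF_q mulrDr scalerAr.
Qed.

(* The candidates for Lam form an F-space of dimension m(t + 1), whereas
   F-linear maps from L to the image of A form one of dimension at most mt. *)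
Lemma exists_qpoly_in_ker (A : 'End(L)) t : (\dim (limg A) <= t)%N ->
  exists Lam : {poly L}, [/\ is_qpoly q Lam, Lam != 0,
    (size Lam <= (q ^ t).+1)%N & forall x, A Lam.[x] = 0].
Proof.
move=> rkA; pose E := limg A; pose b := vbasis {:L}.
pose Lam (v : {ffun 'I_t.+1 -> L}) := \sum_(i < t.+1) v i *: 'X^(q ^ i).
have q_Lam v : is_qpoly q (Lam v).
  by exists t, (fun i => v (inord i)); apply: eq_bigr => i _; rewrite inord_val.
(* The map [x |-> A (Lam v).[x]] is F-linear, hence determined by its values on the basis [b], which
   [f v] records. *)
pose f (v : {ffun 'I_t.+1 -> L}) : {ffun 'I_(\dim {:L}) -> subvs_of E} :=
  [ffun j => vsproj E (A (Lam v).[tnth b j])].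
have [|h hE] := @exists_linfun _ _ _ f.
  move=> a u v; apply/ffunP => j; rewrite !ffunE -linearP -linearP /=.
  do 2!congr (_ _); rewrite !horner_sum scaler_sumr -big_split /=.
  by apply: eq_bigr => i _; rewrite !ffunE !hornerZ mulrDl scalerAl.
have [|v nz_v hv0] := hom_nontrivial_ker h.
  rewrite !dim_ffun dim_subvs dim_L mulnC ltn_mul2r.
  by rewrite -dim_L adim_gt0 ltnS.
exists (Lam v); split=> //.
(* The exponents [q ^ i] are distinct, so [v] can be read off the coefficients of [Lam v]. *)
- apply: contra nz_v => /eqP Lam0; apply/eqP/ffunP => i; rewrite ffunE.
  have := congr1 (fun P : {poly L} => P`_(q ^ i)) Lam0.
  rewrite coef0 coef_sum (bigD1 i) //= coefZ coefXn eqxx mulr1 big1 ?addr0 //.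
  move=> j ne_ji; rewrite coefZ coefXn eqn_exp2l ?card_fin_gt1 //.
  by rewrite eq_sym (negPf (ne_ji : (j : nat) != i)) mulr0.
- apply: leq_trans (size_sum _ _ _) _; apply/bigmax_leqP => i _.
  rewrite (leq_trans (size_scale_leq _ _)) // size_polyXn ltnS.
  by rewrite leq_exp2l ?card_fin_gt1 // -ltnS.
have [|g gE] := @exists_linfun _ L L (fun x => A (Lam v).[x]).
  by move=> a x y; rewrite horner_qpoly_linear // linearP.
move=> x; rewrite -gE (coord_vbasis (memvf x)) linear_sum big1 // => j _.
rewrite linearZ /= gE -tnth_nth.
have := congr1 (fun w : {ffun 'I__ -> subvs_of E} => vsval (w j)) hv0.
by rewrite hE !ffunE vsprojK ?memv_img ?memvf // => ->; rewrite scaler0.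
Qed.

(** By rank-nullity the kernel has dimension at least [m - \dim V > d], so it has more than [q ^ d]
    points, too many roots for a nonzero [P]. *)
Lemma qpoly_image_eq0 P V d : is_qpoly q P -> (size P <= (q ^ d).+1)%N ->
  (forall x, P.[x] \in V) -> (d + \dim V < m)%N -> P = 0.
Proof.
move=> qP szP PV lt_m; apply/eqP/negPn/negP => nzP.
have [|h hE] := @exists_linfun _ L L (fun x : L => P.[x]).
  by move=> a x y; apply: horner_qpoly_linear.
have kerP x : x \in lker h -> P.[x] = 0 by rewrite memv_ker hE => /eqP.
have := leq_trans (size_vanishing nzP kerP) szP.
rewrite ltnS leq_exp2l ?card_fin_gt1 //.
have := limg_ker_dim h fullv; rewrite capfv dim_L.
have : (\dim (limg h) <= \dim V)%N.
  by apply/dimvS/subvP => _ /memv_imgP[x _ ->]; rewrite hE.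
lia.
Qed.

(** The generator of the ideal vanishes on all of [L], and each left factor sends [0] to [0]. *)
Lemma qcongr_eval A B : qcongr q m A B -> forall x : L, A.[x] = B.[x].
Proof.
move=> [s qs eqAB] x; apply/eqP; rewrite -subr_eq0 -hornerN -hornerD eqAB.
rewrite horner_sum big_seq big1 // => u /qs[qu1 _].
rewrite !horner_comp !hornerE exprL_qm subrr.
exact: horner0_qpoly card_fin_gt1 _ qu1.
Qed.

Lemma qcongr0D A B : qcongr q m A 0 -> qcongr q m B 0 -> qcongr q m (A + B) 0.
Proof.
move=> [s1 q1]; rewrite subr0 => ->; move=> [s2 q2]; rewrite subr0 => ->.
exists (s1 ++ s2); last by rewrite big_cat subr0.
by move=> u; rewrite mem_cat => /orP[/q1|/q2].
Qed.

(** Reduction goes monomial by monomial: an exponent [q ^ i] with [m <= i] is lowered to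
    [q ^ (i - m)] until it drops below [q ^ m]. *)
Lemma exists_qcongr_reduced P : is_qpoly q P -> exists R : {poly L},
  [/\ is_qpoly q R, (size R <= (q ^ m.-1).+1)%N & qcongr q m (P - R) 0].
Proof.
have q_gt1 := card_fin_gt1; have m_gt0 : (0 < m)%N by rewrite -dim_L adim_gt0.
have monomial i (c : L) : exists R : {poly L},
    [/\ is_qpoly q R, (size R <= (q ^ m.-1).+1)%N &
    qcongr q m (c *: 'X^(q ^ i) - R) 0].
  elim/ltn_ind: i c => i IHi c; have [lt_im | le_mi] := ltnP i m.
    exists (c *: 'X^(q ^ i)); split; first exact: is_qpolyZXn.
      rewrite (leq_trans (size_scale_leq _ _)) // size_polyXn ltnS leq_exp2l //.
      lia.
    by exists [::] => //; rewrite big_nil subr0 subrr.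
  have [|R [qR szR cR]] := IHi (i - m)%N _ c; first lia.
  exists R; split=> //; rewrite -[_ - R](subrKA (c *: 'X^(q ^ (i - m)))).
  apply: qcongr0D _ cR; exists [:: (c *: 'X^(q ^ (i - m)), 'X)].
    move=> u; rewrite inE => /eqP -> /=.
    by split; [apply: is_qpolyZXn | apply: is_qpolyX].
  by rewrite big_seq1 subr0 comp_Xn_subX ?pchar_nat_card ?subnKC.
move=> [r [p ->]]; elim/big_rec: _ => [|i y _ [R [qR szR cR]]].
  exists 0; rewrite size_poly0; split=> //; first exact: is_qpoly0.
  by exists [::] => //; rewrite big_nil !subr0.
have [S [qS szS cS]] := monomial i (p i).
exists (S + R); split; first exact: is_qpolyD.
  by rewrite (leq_trans (size_polyD _ _)) // geq_max szS.
by rewrite opprD addrACA; apply: qcongr0D.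
Qed.

(** The reduced form of [A - B] has q-degree below [m] and vanishes on [L], hence is zero. *)
Lemma eval_qcongr A B : is_qpoly q A -> is_qpoly q B ->
  (forall x : L, A.[x] = B.[x]) -> qcongr q m A B.
Proof.
move=> qA qB eqAB; have q_gt1 := card_fin_gt1.
have m_gt0 : (0 < m)%N by rewrite -dim_L adim_gt0.
have [R [qR szR cR]] := exists_qcongr_reduced (is_qpolyB q_gt1 qA qB).
suff R0 : R = 0.
  by case: cR => s qs; rewrite R0 !subr0 => eqs; exists s.
apply: (qpoly_image_eq0 qR szR (V := 0%VS)) => [x|]; last by rewrite dimv0; lia.
have := qcongr_eval cR x.
rewrite hornerD hornerN hornerD hornerN eqAB subrr sub0r horner0 memv0.
by move/eqP; rewrite oppr_eq0.
Qed.

End QCongr.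

(** * Correctness of the right-hand side decoding procedure *)

Theorem mainTheorem1
  (q : nat) (F : finFieldType) (L : fieldExtType F) (m n k t : nat)
  (g c e y : 'rV[L]_n) (C Y G : {poly L})
  (hq : #|F| = q)
  (hm : \dim {:L} = m)
  (hk : (1 <= k)%N) (hkn : (k < n)%N) (hnm : (n <= m)%N)
  (hg : free (entries g))
  (ht : (t <= (n - k)./2)%N)
  (hC : is_qpoly q C) (hCdeg : qdeg_lt q C k)
  (hc : c = eval_vec C g)
  (he : rank_weight e = t)
  (hy : y = c + e)
  (hY : is_qpoly q Y) (hYdeg : qdeg_lt q Y n)
  (hYy : forall i, Y.[g 0 i] = y 0 i)
  (hG : is_qpoly q G) (hGdeg : qdeg_le q G (m - n))
  (hGim : forall z : L, z \in <<entries g>>%VS <-> exists x : L, G.[x] = z) :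
  (exists Lam N : {poly L},
      key_solution q m n k t Y G Lam N /\ (Lam, N) <> (0, 0)) /\
  (forall Lam N : {poly L},
      key_solution q m n k t Y G Lam N -> (Lam, N) <> (0, 0) ->
      [/\ Lam <> 0,
          N = C \Po (G \Po Lam),
          forall Q R, right_division q N Lam Q R <-> Q = C \Po G /\ R = 0 &
          forall Q R, right_division q (C \Po G) G Q R <-> Q = C /\ R = 0]) /\
  (forall v : 'rV[L]_n, decoder_output q m k t g Y G v <-> v = c).
Proof.
have q_gt1 : (1 < q)%N by apply: card_fin_gt1 hq.
have char_q : [pchar L].-nat q by apply: pchar_nat_card hq.
have qcomp (P Q : {poly L}) :
    is_qpoly q P -> is_qpoly q Q -> is_qpoly q (P \Po Q).
  exact: is_qpoly_comp.
have qCG := qcomp _ _ hC hG.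
have ht2 : (t.*2 <= n - k)%N by lia.
have szC : (size C <= (q ^ k.-1).+1)%N.
  by rewrite -qdeg_leE // -qdeg_lt_le.
have szG : (size G <= (q ^ (m - n)).+1)%N by rewrite -qdeg_leE.
(* Entries of a free family are nonzero, and the image of [G] contains one since [0 < n]. *)
have nzG : G != 0.
  have n_gt0 : (0 < n)%N by lia.
  have g0_in : g 0 (Ordinal n_gt0) \in entries g.
    by apply/tnthP; exists (Ordinal n_gt0); rewrite tnth_mktuple.
  apply/eqP => G0; have [x] := (hGim _).1 (memv_span g0_in).
  rewrite G0 horner0 => g0; case/negP: (free_not0 hg g0_in); exact/eqP.
have YGE x : (Y - C).[G.[x]] \in <<entries e>>%VS.
  have [|h hE] := @exists_linfun _ L L (fun x => (Y - C).[x]).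
    by move=> a u v; apply: (horner_qpoly_linear hq); apply: is_qpolyB.
  (* On each entry of [g], [h] takes the value [y_i - c_i = e_i]. *)
  rewrite -hE; have -> : <<entries e>>%VS = (h @: <<entries g>>)%VS.
    rewrite limg_span; congr <<_>>%VS.
    rewrite -[RHS]/(val (map_tuple h (entries g))); congr val.
    apply: eq_from_tnth => i.
    rewrite !(tnth_map, tnth_mktuple) hE.
    by rewrite hornerD hornerN hYy hy hc !mxE addrAC subrr add0r.
  by apply/memv_img/hGim; exists x.
have YGE_Lam (Lam N : {poly L}) : key_solution q m n k t Y G Lam N ->
    forall x : L, (N - (C \Po (G \Po Lam))).[x] \in <<entries e>>%VS.
  move=> [qLam qN cN _ _] x; rewrite hornerD hornerN.
  rewrite -(qcongr_eval hq hm cN) !horner_comp.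
  by have := YGE Lam.[x]; rewrite hornerD hornerN.
have size_CG (Lam : {poly L}) : (size Lam <= (q ^ t).+1)%N ->
    (size (C \Po (G \Po Lam)) <= (q ^ (k + m - n + t - 1)).+1)%N.
  move=> szLam; have -> : (k + m - n + t - 1 = k.-1 + (m - n + t))%N by lia.
  by apply: size_comp_expn_leq szC (size_comp_expn_leq szG szLam).
have key_unique (Lam N : {poly L}) :
    key_solution q m n k t Y G Lam N -> (Lam, N) <> (0, 0) ->
    Lam <> 0 /\ N = C \Po (G \Po Lam).
  move=> sol nz; have := YGE_Lam _ _ sol; case: sol => qLam qN cN dLam dN imN.
  have eqN : N = C \Po (G \Po Lam).
    apply/subr0_eq; pose d := (k + m - n + t - 1)%N.
    apply: (@qpoly_image_eq0 q m F L hq hm _ _ d _ _ imN).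
    - by apply: is_qpolyB => //; apply: (qcomp) => //; apply: qcomp.
    - apply: leq_trans (size_polyD _ _) _; rewrite size_polyN geq_max.
      rewrite size_CG -?qdeg_leE // andbT; exact: dN.
    (* The decoding radius enters here: [d + t = k + m - n + 2t - 1 < m] because [2t <= n - k]. *)
    - rewrite -[\dim _]/(rank_weight e) he; lia.
  (* If [Lam = 0], then [N] is the constant [C.[G.[0]]], which is zero, so the pair is [(0, 0)]. *)
  split=> // Lam0; case: nz; rewrite eqN Lam0; congr (_, _).
  by do 2!rewrite comp_poly0r -horner_coef0 (horner0_qpoly q_gt1) //.
have divNLam (Lam N : {poly L}) :
    key_solution q m n k t Y G Lam N -> (Lam, N) <> (0, 0) ->
    forall Q R, right_division q N Lam Q R <-> Q = C \Po G /\ R = 0.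
  move=> sol nz Q R; have [nzLam eqN] := key_unique _ _ sol nz.
  have [qLam _ _ _ _] := sol.
  rewrite eqN comp_polyA; split; last first.
    (* The remainder [0] passes [qdeg_lt] by its first clause, even if the divisor has q-degree
       0. *)
    by move=> [-> ->]; split; rewrite ?addr0 /qdeg_lt ?eqxx //; apply: is_qpoly0.
  by apply: right_division_remainder => //; apply/eqP.
have divCG (Q R : {poly L}) : right_division q (C \Po G) G Q R <-> Q = C /\ R = 0.
  split; first exact: right_division_remainder.
  by move=> [-> ->]; split; rewrite ?addr0 /qdeg_lt ?eqxx //; apply: is_qpoly0.
have exists_sol : exists Lam N : {poly L},
    key_solution q m n k t Y G Lam N /\ (Lam, N) <> (0, 0).
  have [|A AE] := @exists_linfun _ L L (fun x => (Y - C).[G.[x]]).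
    by move=> a u v; rewrite !(horner_qpoly_linear hq) //; apply: is_qpolyB.
  have [|Lam [qLam nzLam szLam Lam_ker]] :=
    @exists_qpoly_in_ker q m F L hq hm A t.
    (* The rank of [A] is at most [t] because its image lies in the span of [e]. *)
    rewrite -he; apply/dimvS/subvP => _ /memv_imgP[x _ ->].
    by rewrite AE.
  exists Lam, (C \Po (G \Po Lam)); split; last first.
    by case=> /eqP; rewrite (negPf nzLam).
  have qGLam := qcomp _ _ hG qLam; have qCGLam := qcomp _ _ hC qGLam.
  split; rewrite ?qdeg_leE ?size_CG //.
  apply: (eval_qcongr hq hm) => [||x] //; first exact: qcomp.
  by apply/eqP; rewrite -subr_eq0 !horner_comp -hornerN -hornerD -AE Lam_ker.
split=> //; split=> [Lam N sol nz | v].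
  by have [? ?] := key_unique _ _ sol nz; split=> //; apply: divNLam.
split=> [[Lam [N [Q1 [R1 [Q2 [R2 [sol nz div1 div2 ->]]]]]]] | ->].
  have [eqQ1 _] := (divNLam _ _ sol nz _ _).1 div1.
  by move: div2; rewrite eqQ1 hc => /divCG[-> _].
have [Lam [N [sol nz]]] := exists_sol.
by exists Lam, N, (C \Po G), 0, C, 0; split=> //; [apply/divNLam | apply/divCG].
Qed.
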